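(* All nearly integrable $\mathbf{SO}(3)$ structures with 6-dimensional transitive symmetry group $G$ have (skew symmetric) torsion of the form $$T=t_1\,\theta^1\wedge\theta^2\wedge\theta^4+t_2\,\theta^1\wedge\theta^3\wedge\theta^5,\qquad t_1,t_2\in\mathbb{R}.$$ There are three families of such geometries, described in terms of the constants $t_1,t_2$ and the constants $a,b\in\mathbb{R}$ entering the reduced characteristic connection ($\tilde\gamma^1=-b\,\tilde\theta^3+a\,\tilde\theta^5$, $\tilde\gamma^2=a\,\tilde\theta^3+b\,\tilde\theta^5$ on $G$): (1) $b=t_1=t_2=0$, and $a$ arbitrary; (2) $a=b=0$ and $t_1,t_2$ arbitrary; (3) $a=0$, $b=\dfrac{t_1-2t_2}{2\sqrt3}$ and $t_1,t_2$ arbitrary.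
   Context: An $\mathbf{SO}(3)$ structure on a 5-dimensional Riemannian manifold $(M,g)$ is given by a rank 3 tensor field $\Upsilon$ such that the map $v\mapsto\Upsilon_v\in\mathrm{End}(TM)$, $(\Upsilon_v)_{ij}=\Upsilon_{ijk}v_k$, is totally symmetric, trace free and satisfies $\Upsilon_v^2v=g(v,v)v$. Adapted coframes are $g$-orthonormal coframes with $\Upsilon=\tfrac12\theta_1(6\theta_2^2+6\theta_4^2-2\theta_1^2-3\theta_3^2-3\theta_5^2)+\tfrac{3\sqrt3}{2}\theta_4(\theta_5^2-\theta_3^2)+3\sqrt3\theta_2\theta_3\theta_5$; they form an $\mathbf{SO}(3)$ bundle $F(M)$. The structure is nearly integrable if $(\nabla^{LC}_v\Upsilon)(v,v,v)\equiv0$; then there is a unique characteristic connection, i.e. a connection $\Gamma=\gamma^1E_1+\gamma^2E_2+\gamma^3E_3$ (in adapted coframes) whose torsion $d\theta^i+\Gamma^i{}_j\wedge\theta^j=\tfrac12T_{ijk}\theta^j\wedge\theta^k$ is totally skew, and one sets $T=\tfrac16T_{ijk}\theta^i\wedge\theta^j\wedge\theta^k$. Here $e_{ij}$ is the antisymmetric $5\times5$ matrix with $1$ at $(i,j)$, $-1$ at $(j,i)$, and $E_1=\sqrt3e_{15}+e_{23}+e_{45}$, $E_2=\sqrt3e_{13}+e_{25}+e_{34}$, $E_3=2e_{24}+e_{35}$. Symmetries are diffeomorphisms preserving $g$ and $\Upsilon$. When there is a 6-dimensional transitive symmetry group $G$, (locally) $M=G/H$ with $\dim H=1$, and $G$ is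 identified with a reduction of $F(M)$, the adapted frames in the reduction being chosen so that the isotropy algebra is spanned by $E_3$. Let $\tilde\theta^i$ and $\tilde\gamma^I$ be the pull-backs to $G$ of the tautological (lifted) coframe and of the components of the lifted characteristic connection $\tilde\Gamma=\tilde\gamma^IE_I$. Then $(\tilde\theta^1,\dots,\tilde\theta^5,\tilde\gamma^3)$ is a left invariant coframe on $G$, $\tilde\gamma^1,\tilde\gamma^2$ are constant coefficient combinations of the $\tilde\theta^i$, necessarily of the form $\tilde\gamma^1=-b\tilde\theta^3+a\tilde\theta^5$, $\tilde\gamma^2=a\tilde\theta^3+b\tilde\theta^5$ with $a,b\in\mathbb{R}$, and $d\tilde\theta^i+\tilde\Gamma^i{}_j\wedge\tilde\theta^j=\tfrac12T_{ijk}\tilde\theta^j\wedge\tilde\theta^k$ with constant $T_{ijk}$. ''Geometry in the family'' means that such a left invariant system (which determines $g$ and $\Upsilon$ by descending to $G/H$ the expressions $\sum\tilde\theta_i^2$ and $\tfrac12\tilde\theta_1(6\tilde\theta_2^2+6\tilde\theta_4^2-2\tilde\theta_1^2-3\tilde\theta_3^2-3\tilde\theta_5^2)+\tfrac{3\sqrt3}{2}\tilde\theta_4(\tilde\theta_5^2-\tilde\theta_3^2)+3\sqrt3\tilde\theta_2\tilde\theta_3\tilde\theta_5$, respectively) exists for the given parameter values. *)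

(* Defs.v *)
From HB Require Import structures.
From mathcomp Require Import all_boot all_order all_algebra.
From mathcomp Require Import reals.

Set Implicit Arguments.
Unset Strict Implicit.
Unset Printing Implicit Defensive.

Import Order.TTheory GRing.Theory Num.Theory.
Local Open Scope ring_scope.

(* A Lie group [G] enters through its Lie algebra [g]: left invariant one-forms
   on [G] are linear forms on [g], left invariant tensors are multilinear
   functions on [g], and the exterior derivative of a left invariant one-form is
   [(d al)(X, Y) = - al [X, Y]].  The wedge product carries no factor 1/2, i.e.
   [(al /\ be)(X, Y) = al X * be Y - al Y * be X]. *)

(* The one-based indices [1, ..., 5], as elements of ['I_5]. *)
Definition ix (k : nat) : 'I_5 := inord k.-1.

Section SO3Algebra.
Variable R : realType.
Implicit Types (U : 'I_5 -> 'I_5 -> 'I_5 -> R) (v : 'cV[R]_5).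

Definition eskew (i j : nat) : 'M[R]_5 :=
  delta_mx (ix i) (ix j) - delta_mx (ix j) (ix i).

Definition E1 : 'M[R]_5 := Num.sqrt 3 *: eskew 1 5 + eskew 2 3 + eskew 4 5.
Definition E2 : 'M[R]_5 := Num.sqrt 3 *: eskew 1 3 + eskew 2 5 + eskew 3 4.
Definition E3 : 'M[R]_5 := 2 *: eskew 2 4 + eskew 3 5.

Definition Upsilon_mx U v : 'M[R]_5 :=
  \matrix_(i, j) \sum_k U i j k * v k 0.

(* [U] holds the components of [Upsilon] in a [g]-orthonormal frame, so [g] is
   the standard inner product of column vectors. *)
Record SO3_tensor U : Prop := {
  Upsilon_sym12 : forall i j k, U i j k = U j i k;
  Upsilon_sym23 : forall i j k, U i j k = U i k j;
  Upsilon_tracefree : forall v, \tr (Upsilon_mx U v) = 0;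
  Upsilon_square : forall v,
    Upsilon_mx U v *m Upsilon_mx U v *m v = (\sum_i v i 0 ^+ 2) *: v
}.

Definition Upsilon_cubic v : R :=
  let x1 := v (ix 1) 0 in let x2 := v (ix 2) 0 in let x3 := v (ix 3) 0 in
  let x4 := v (ix 4) 0 in let x5 := v (ix 5) 0 in
  2^-1 * x1 * (6 * x2 ^+ 2 + 6 * x4 ^+ 2 - 2 * x1 ^+ 2
               - 3 * x3 ^+ 2 - 3 * x5 ^+ 2)
  + 3 * Num.sqrt 3 / 2 * x4 * (x5 ^+ 2 - x3 ^+ 2)
  + 3 * Num.sqrt 3 * x2 * x3 * x5.

Definition adapted U : Prop :=
  forall v, \sum_i \sum_j \sum_k U i j k * v i 0 * v j 0 * v k 0
            = Upsilon_cubic v.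

End SO3Algebra.

Section LeftInvariant.
Variables (R : realType) (g : vectType R).
Implicit Types (br : g -> g -> g) (h : g) (U : 'I_5 -> 'I_5 -> 'I_5 -> R).

Record lie_bracket br : Prop := {
  br_linearl : forall (c : R) X Y Z, br (c *: X + Y) Z = c *: br X Z + br Y Z;
  br_linearr : forall (c : R) X Y Z, br X (c *: Y + Z) = c *: br X Y + br X Z;
  br_alt : forall X, br X X = 0;
  br_jacobi : forall X Y Z, br X (br Y Z) + br Y (br Z X) + br Z (br X Y) = 0
}.

Definition form1 : Type := 'Hom(g, R^o).
Implicit Types (al be ga : form1) (th : 'I_5 -> form1)
  (om : 'I_5 -> 'I_5 -> form1).

Definition ext_d br al (X Y : g) : R := - (al (br X Y) : R).

Definition wedge al be (X Y : g) : R :=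
  (al X : R) * (be Y : R) - (al Y : R) * (be X : R).

Definition wedge3 al be ga (X Y Z : g) : R :=
  (al X : R) * wedge be ga Y Z + (al Y : R) * wedge be ga Z X
  + (al Z : R) * wedge be ga X Y.

Definition metric th (X Y : g) : R := \sum_i (th i X : R) * (th i Y : R).

Definition Upsilon U th (X Y Z : g) : R :=
  \sum_i \sum_j \sum_k U i j k * (th i X : R) * (th j Y : R) * (th k Z : R).

(* The [G]-invariant SO(3) structure on [G/H], [dim G = 6], where the Lie
   algebra of [H] is the line spanned by [h], together with the lift [th] to [G]
   of an adapted coframe: [th] is semibasic, and [metric th] and [Upsilon U th]
   are invariant under [ad h], i.e. they descend to [G/H]. *)
Record invariant_SO3_structure br h U th : Prop := {
  group_dim : \dim {: g} = 6%N;
  group_bracket : lie_bracket br;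
  isotropy_neq0 : h != 0;
  coframe_kernel : forall X, (forall i, th i X = 0) <-> X \in <[h]>%VS;
  Upsilon_SO3 : SO3_tensor U;
  Upsilon_adapted : adapted U;
  metric_inv : forall X Y,
    metric th (br h X) Y + metric th X (br h Y) = 0;
  Upsilon_inv : forall X Y Z,
    Upsilon U th (br h X) Y Z + Upsilon U th X (br h Y) Z
    + Upsilon U th X Y (br h Z) = 0
}.

(* Restriction to [G] of the Levi-Civita connection form of the orthonormal
   frame bundle. *)
Definition levi_civita br th om : Prop :=
  (forall i j, om i j = - om j i) /\
  (forall i X Y, ext_d br (th i) X Y + \sum_j wedge (om i j) (th j) X Y = 0).

(* The components of [Upsilon] are constant in adapted frames, so only the
   connection terms of the covariant derivative remain. *)
Definition nabla_Upsilon U om (X : g) (i j k : 'I_5) : R :=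
  - \sum_l ((om l i X : R) * U l j k + (om l j X : R) * U i l k
            + (om l k X : R) * U i j l).

Definition nearly_integrable br U th : Prop :=
  exists om, levi_civita br th om /\
    forall X, \sum_i \sum_j \sum_k nabla_Upsilon U om X i j k
                * (th i X : R) * (th j X : R) * (th k X : R) = 0.

Definition Gamma (ga1 ga2 ga3 : form1) (i j : 'I_5) : form1 :=
  E1 R i j *: ga1 + E2 R i j *: ga2 + E3 R i j *: ga3.

(* [Gamma_isotropy] and [Gamma_equivariant] say that [Gamma] is the restriction
   of a connection form to [G], seen as a reduction of the bundle of adapted
   frames in which the isotropy algebra is spanned by [E3]: the fundamental
   vector field of [E3] is [h], and [L_h Gamma = - [E3, Gamma]]. *)
Record characteristic_connection br h th (ga1 ga2 ga3 : form1)
    (T : 'I_5 -> 'I_5 -> 'I_5 -> R) : Prop := {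
  Gamma_isotropy : forall i j, Gamma ga1 ga2 ga3 i j h = E3 R i j;
  Gamma_equivariant : forall i j X,
    (Gamma ga1 ga2 ga3 i j (br h X) : R) =
    \sum_k (E3 R i k * (Gamma ga1 ga2 ga3 k j X : R)
            - (Gamma ga1 ga2 ga3 i k X : R) * E3 R k j);
  torsion_skew12 : forall i j k, T i j k = - T j i k;
  torsion_skew23 : forall i j k, T i j k = - T i k j;
  torsion_eq : forall i X Y,
    ext_d br (th i) X Y + \sum_j wedge (Gamma ga1 ga2 ga3 i j) (th j) X Y
    = 2^-1 * \sum_j \sum_k T i j k * wedge (th j) (th k) X Y
}.

Definition torsion_form th (T : 'I_5 -> 'I_5 -> 'I_5 -> R) (X Y Z : g) : R :=
  6^-1 * \sum_i \sum_j \sum_k T i j k * wedge3 (th i) (th j) (th k) X Y Z.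

(* A nearly integrable SO(3) structure with a 6-dimensional transitive symmetry
   group, described by its left invariant system on that group. *)
Record homogeneous_system br h U th (ga1 ga2 ga3 : form1)
    (T : 'I_5 -> 'I_5 -> 'I_5 -> R) : Prop := {
  system_SO3 : invariant_SO3_structure br h U th;
  system_nearly_integrable : nearly_integrable br U th;
  system_connection : characteristic_connection br h th ga1 ga2 ga3 T
}.

Definition torsion_normal_form th (T : 'I_5 -> 'I_5 -> 'I_5 -> R)
    (t1 t2 : R) : Prop :=
  forall X Y Z, torsion_form th T X Y Z =
    t1 * wedge3 (th (ix 1)) (th (ix 2)) (th (ix 4)) X Y Z
    + t2 * wedge3 (th (ix 1)) (th (ix 3)) (th (ix 5)) X Y Z.

Definition connection_normal_form th (ga1 ga2 : form1) (a b : R) : Prop :=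
  ga1 = - b *: th (ix 3) + a *: th (ix 5) /\
  ga2 = a *: th (ix 3) + b *: th (ix 5).

End LeftInvariant.

(* Main.v *)
Require Import Defs.
From HB Require Import structures.
From mathcomp Require Import all_boot all_order all_algebra.
From mathcomp Require Import reals ring lra.

Set Implicit Arguments.
Unset Strict Implicit.
Unset Printing Implicit Defensive.

Import Order.TTheory GRing.Theory Num.Theory.
Local Open Scope ring_scope.

(** The matrix [E3] rotates the coframe with weight 0 on [th 1], weight 2 on
    the plane of [th 2, th 4] and weight 1 on the plane of [th 3, th 5], and
    every object of the system is equivariant under [h].  The pair [ga1, ga2]
    vanishes on [h] and rotates with weight 1, so it is the image of
    [th 3, th 5] under a map commuting with rotations, which leaves the two
    parameters [a] and [b] ([connection_normal]).  The Jacobi identity with [h]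
    as one of the three vectors says that the torsion is an invariant 3-form
    ([torsion_equivariant]); as the weights 0, 1, 2 occur, the only invariant
    3-forms are [th 1] times the area form of one of the two planes
    ([torsion_normal]).

    With both normal forms in place, the torsion equation gives all brackets
    modulo [h] as explicit functions of [a, b, t1, t2] ([coord_bracket]).  For
    four well chosen triples of frame vectors, some component of the Jacobi
    identity does not see the unknown [h]-components of the brackets, and
    yields (with [s] the square root of 3)
    [a t1 = 0], [a (t1 - 2 t2 - 2 s b) = 0], [b (t1 - 2 t2 - 2 s b) = 0] and
    [a (6 b + s t2) = 0] ([structure_relations]).  If [a] is nonzero, these
    force [t1 = 0] and [t2 = - s b], hence [3 b = 0]; if [a = 0], only the third
    relation remains, and it gives the other two families.

    Conversely, the other components of the Jacobi identity dictate the missing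
    differential of [ga3], and the bracket completed in this way on a
    6-dimensional space satisfies the Jacobi identity on each family
    ([structure_jacobi]).  Near integrability is then automatic: the Levi-Civita
    connection is [Gamma] plus half of the torsion, [Gamma] takes its values in
    the stabilizer of [Upsilon], and the skew torsion is killed when it is
    evaluated twice on the same vector ([characteristic_nearly_integrable]). *)

(** * Indices and the matrices of so(3) *)

Lemma val_ix k : (0 < k <= 5)%N -> ix k = k.-1 :> nat.
Proof. by case: k => // k /= k5; rewrite inordK. Qed.

Lemma ord5_ind (P : 'I_5 -> Prop) :
  P (ix 1) -> P (ix 2) -> P (ix 3) -> P (ix 4) -> P (ix 5) -> forall i, P i.
Proof.
move=> P1 P2 P3 P4 P5 [[|[|[|[|[|i]]]]] i5] //.
- by have <- : ix 1 = Ordinal i5 by apply: val_inj; rewrite /= val_ix.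
- by have <- : ix 2 = Ordinal i5 by apply: val_inj; rewrite /= val_ix.
- by have <- : ix 3 = Ordinal i5 by apply: val_inj; rewrite /= val_ix.
- by have <- : ix 4 = Ordinal i5 by apply: val_inj; rewrite /= val_ix.
- by have <- : ix 5 = Ordinal i5 by apply: val_inj; rewrite /= val_ix.
Qed.

Lemma big_ix (V : nmodType) (F : 'I_5 -> V) :
  \sum_i F i = F (ix 1) + F (ix 2) + F (ix 3) + F (ix 4) + F (ix 5).
Proof.
rewrite !big_ord_recl big_ord0 addr0 !addrA.
by do !congr (_ + _); congr (F _); apply: val_inj; rewrite /= val_ix.
Qed.

Lemma ix_eqE j k : (0 < j <= 5)%N -> (0 < k <= 5)%N ->
  (ix j == ix k) = (j == k).
Proof.
by move=> j5 k5; rewrite -val_eqE /= !val_ix //; case: j k j5 k5 => [|j] [|k].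
Qed.

Section Entries.
Variable R : realType.

Lemma sqrt3 : Num.sqrt 3 * Num.sqrt 3 = 3 :> R.
Proof. by rewrite -expr2 sqr_sqrtr. Qed.

Lemma sqrt3_neq0 : Num.sqrt 3 != 0 :> R.
Proof. by rewrite gt_eqF // sqrtr_gt0. Qed.

Definition entry1 (i j : nat) : R :=
  match i, j with
  | 1, 5 => Num.sqrt 3 | 5, 1 => - Num.sqrt 3
  | 2, 3 | 4, 5 => 1 | 3, 2 | 5, 4 => -1
  | _, _ => 0
  end.
Definition entry2 (i j : nat) : R :=
  match i, j with
  | 1, 3 => Num.sqrt 3 | 3, 1 => - Num.sqrt 3
  | 2, 5 | 3, 4 => 1 | 5, 2 | 4, 3 => -1
  | _, _ => 0
  end.
Definition entry3 (i j : nat) : R :=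
  match i, j with
  | 2, 4 => 2 | 4, 2 => -2 | 3, 5 => 1 | 5, 3 => -1
  | _, _ => 0
  end.

Lemma E1_entry i j : (0 < i <= 5)%N -> (0 < j <= 5)%N ->
  E1 R (ix i) (ix j) = entry1 i j.
Proof.
move=> i5 j5; rewrite /E1 !mxE !ix_eqE //.
by case: i i5 => [|[|[|[|[|[|i]]]]]] // _;
  case: j j5 => [|[|[|[|[|[|j]]]]]] // _ /=; ring.
Qed.

Lemma E2_entry i j : (0 < i <= 5)%N -> (0 < j <= 5)%N ->
  E2 R (ix i) (ix j) = entry2 i j.
Proof.
move=> i5 j5; rewrite /E2 !mxE !ix_eqE //.
by case: i i5 => [|[|[|[|[|[|i]]]]]] // _;
  case: j j5 => [|[|[|[|[|[|j]]]]]] // _ /=; ring.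
Qed.

Lemma E3_entry i j : (0 < i <= 5)%N -> (0 < j <= 5)%N ->
  E3 R (ix i) (ix j) = entry3 i j.
Proof.
move=> i5 j5; rewrite /E3 !mxE !ix_eqE //.
by case: i i5 => [|[|[|[|[|[|i]]]]]] // _;
  case: j j5 => [|[|[|[|[|[|j]]]]]] // _ /=; ring.
Qed.

Lemma E3E1_bracket : E3 R *m E1 R - E1 R *m E3 R = E2 R.
Proof.
move: (E1 R) (E2 R) (E3 R) E1_entry E2_entry E3_entry => M1 M2 M3 H1 H2 H3.
apply/matrixP=> i j; rewrite !mxE !big_ix.
by elim/ord5_ind: i; elim/ord5_ind: j; rewrite !H1 // !H2 // !H3 //=; ring.
Qed.

Lemma E3E2_bracket : E3 R *m E2 R - E2 R *m E3 R = - E1 R.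
Proof.
move: (E1 R) (E2 R) (E3 R) E1_entry E2_entry E3_entry => M1 M2 M3 H1 H2 H3.
apply/matrixP=> i j; rewrite !mxE !big_ix.
by elim/ord5_ind: i; elim/ord5_ind: j; rewrite !H1 // !H2 // !H3 //=; ring.
Qed.

Lemma E1_skew i j : E1 R i j = - E1 R j i.
Proof.
move: (E1 R) E1_entry => M HM.
by elim/ord5_ind: i; elim/ord5_ind: j; rewrite !HM //= ?opprK ?oppr0.
Qed.

Lemma E2_skew i j : E2 R i j = - E2 R j i.
Proof.
move: (E2 R) E2_entry => M HM.
by elim/ord5_ind: i; elim/ord5_ind: j; rewrite !HM //= ?opprK ?oppr0.
Qed.

Lemma E3_skew i j : E3 R i j = - E3 R j i.
Proof.
move: (E3 R) E3_entry => M HM.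
by elim/ord5_ind: i; elim/ord5_ind: j; rewrite !HM //= ?opprK ?oppr0.
Qed.

End Entries.

(** * The adapted cubic and its tensor *)

Section Tensor.
Variable R : realType.
Implicit Types (x y z : 'I_5 -> R).

Definition delta (i j : 'I_5) : R := (i == j)%:R.

Lemma delta_ix i j : (0 < i <= 5)%N -> (0 < j <= 5)%N ->
  delta (ix i) (ix j) = (i == j)%:R.
Proof. by move=> *; rewrite /delta ix_eqE. Qed.

Lemma delta_sum (F : 'I_5 -> R) i : \sum_j F j * delta i j = F i.
Proof.
rewrite (bigD1 i) //= {1}/delta eqxx mulr1 big1 ?addr0 // => j ji.
by rewrite /delta eq_sym (negPf ji) mulr0.
Qed.

(** The cubic form is handled through its polarization, and [polar_square] and
    [polar_product] polarize [3 x_i x_j ^ 2] and [6 x_i x_j x_k]. *)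
Definition polar_square x y z (i j : nat) : R :=
  x (ix i) * y (ix j) * z (ix j) + x (ix j) * y (ix i) * z (ix j)
  + x (ix j) * y (ix j) * z (ix i).

Definition polar_product x y z (i j k : nat) : R :=
  x (ix i) * (y (ix j) * z (ix k) + y (ix k) * z (ix j))
  + x (ix j) * (y (ix i) * z (ix k) + y (ix k) * z (ix i))
  + x (ix k) * (y (ix i) * z (ix j) + y (ix j) * z (ix i)).

Definition polar_cubic x y z : R :=
  - (x (ix 1) * y (ix 1) * z (ix 1))
  + polar_square x y z 1 2 + polar_square x y z 1 4
  - 2^-1 * (polar_square x y z 1 3 + polar_square x y z 1 5)
  + Num.sqrt 3 / 2 * (polar_square x y z 4 5 - polar_square x y z 4 3
                      + polar_product x y z 2 3 5).

Lemma polar_sym12 x y z : polar_cubic x y z = polar_cubic y x z.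
Proof. by rewrite /polar_cubic /polar_square /polar_product; ring. Qed.

Lemma polar_sym23 x y z : polar_cubic x y z = polar_cubic x z y.
Proof. by rewrite /polar_cubic /polar_square /polar_product; ring. Qed.

Lemma polar_sum x y z :
  \sum_k polar_cubic x y (delta k) * z k = polar_cubic x y z.
Proof.
by rewrite big_ix /polar_cubic /polar_square /polar_product !delta_ix //=; ring.
Qed.

(** Evaluating the polarization on basis vectors makes the symmetries of the
    tensor instances of those of [polar_cubic]. *)
Definition adapted_tensor (i j k : 'I_5) : R :=
  polar_cubic (delta i) (delta j) (delta k).

Lemma adapted_tensor_sum1 x i j :
  \sum_k adapted_tensor i j k * x k = polar_cubic (delta i) (delta j) x.
Proof. exact: polar_sum. Qed.

Lemma adapted_tensor_sum2 x y i :
  \sum_j \sum_k adapted_tensor i j k * x j * y k = polar_cubic (delta i) x y.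
Proof.
rewrite polar_sym23 -polar_sum; apply: eq_bigr => j _.
rewrite polar_sym23 -adapted_tensor_sum1 mulr_suml; apply: eq_bigr => k _.
by rewrite mulrAC.
Qed.

Lemma adapted_tensor_sum3 x y z :
  \sum_i \sum_j \sum_k adapted_tensor i j k * x i * y j * z k = polar_cubic x y z.
Proof.
rewrite polar_sym12 polar_sym23 -polar_sum; apply: eq_bigr => i _.
rewrite polar_sym23 polar_sym12 -adapted_tensor_sum2 mulr_suml; apply: eq_bigr => j _.
rewrite mulr_suml; apply: eq_bigr => k _.
by rewrite -!mulrA; congr (_ * _); rewrite mulrCA; congr (_ * _); rewrite mulrC.
Qed.

Lemma adapted_tensor_SO3 : SO3_tensor adapted_tensor.
Proof.
have sq3 := sqrt3 R.
split=> [i j k|i j k|v|v].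
- exact: polar_sym12.
- exact: polar_sym23.
- rewrite /mxtrace big_ix !mxE !adapted_tensor_sum1.
  by rewrite /polar_cubic /polar_square /polar_product !delta_ix //=; field.
- have mxv (x : 'cV[R]_5) (i : 'I_5) : (Upsilon_mx adapted_tensor v *m x) i 0 =
      polar_cubic (delta i) (x^~ 0) (v^~ 0).
    rewrite !mxE -adapted_tensor_sum2; apply: eq_bigr => // j _.
    rewrite mxE mulr_suml; apply: eq_bigr => // k _.
    by rewrite mulrAC.
  rewrite -mulmxA; apply/matrixP=> i j; rewrite ord1 mxv !mxE big_ix.
  rewrite /polar_cubic /polar_square /polar_product !mxv /polar_cubic /polar_square
    /polar_product; elim/ord5_ind: i; move: (v (ix 1) 0) (v (ix 2) 0)
    (v (ix 3) 0) (v (ix 4) 0) (v (ix 5) 0) => v1 v2 v3 v4 v5.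
  all: by rewrite !delta_ix //=; field: sq3.
Qed.

Lemma adapted_tensor_adapted : adapted adapted_tensor.
Proof. by move=> v; rewrite adapted_tensor_sum3 /polar_cubic /polar_square /polar_product
  /Upsilon_cubic; field. Qed.

Definition act (M : 'M[R]_5) x (i : 'I_5) : R := \sum_j M i j * x j.

Lemma polar_comb3 x y z u v w (c1 c2 c3 : R) :
  (forall i, z i = u i * c1 + v i * c2 + w i * c3) ->
  polar_cubic x y z
  = polar_cubic x y u * c1 + polar_cubic x y v * c2 + polar_cubic x y w * c3.
Proof. by move=> zE; rewrite /polar_cubic /polar_square /polar_product !zE; ring. Qed.

(** By symmetry, the three terms of an infinitesimal invariance coincide on the
    diagonal. *)
Lemma polar_invariant_diag x y :
  polar_cubic y x x + polar_cubic x y x + polar_cubic x x y = 0 ->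
  polar_cubic x x y = 0.
Proof.
rewrite polar_sym12 polar_sym23 -mulr2n -mulrSr => /eqP.
by rewrite mulrn_eq0 => /eqP.
Qed.

(** [E1], [E2] and [E3] lie in the Lie algebra of the stabilizer of the cubic;
    this is what makes a connection with values in their span preserve
    [Upsilon]. *)
Lemma polar_E1 x y z : polar_cubic (act (E1 R) x) y z
  + polar_cubic x (act (E1 R) y) z + polar_cubic x y (act (E1 R) z) = 0.
Proof.
have sq3 := sqrt3 R; move: (E1 R) (E1_entry R) => M HM.
by rewrite /polar_cubic /polar_square /polar_product /act !big_ix !HM //=; field: sq3.
Qed.

Lemma polar_E2 x y z : polar_cubic (act (E2 R) x) y z
  + polar_cubic x (act (E2 R) y) z + polar_cubic x y (act (E2 R) z) = 0.
Proof.
have sq3 := sqrt3 R; move: (E2 R) (E2_entry R) => M HM.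
by rewrite /polar_cubic /polar_square /polar_product /act !big_ix !HM //=; field: sq3.
Qed.

Lemma polar_E3 x y z : polar_cubic (act (E3 R) x) y z
  + polar_cubic x (act (E3 R) y) z + polar_cubic x y (act (E3 R) z) = 0.
Proof.
move: (E3 R) (E3_entry R) => M HM.
by rewrite /polar_cubic /polar_square /polar_product /act !big_ix !HM //=; field.
Qed.

End Tensor.

(** * Left invariant forms and adapted dual frames *)

Section Alternating.
Variable R : realType.
Implicit Types (F T : 'I_5 -> 'I_5 -> 'I_5 -> R).

Definition totally_skew F :=
  (forall i j k, F i j k = - F j i k) /\ (forall i j k, F i j k = - F i k j).

(** The value of the 3-form [th i /\ th j /\ th k] on the vectors with indices
    [l, m, n] of a dual frame. *)
Definition alt3 (i j k l m n : 'I_5) : R :=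
  delta R i l * (delta R j m * delta R k n - delta R j n * delta R k m)
  + delta R i m * (delta R j n * delta R k l - delta R j l * delta R k n)
  + delta R i n * (delta R j l * delta R k m - delta R j m * delta R k l).

Lemma alt3_skew i j k : totally_skew (alt3 i j k).
Proof. by split=> l m n; rewrite /alt3; ring. Qed.

Lemma delta_sum3 (f : 'I_5 -> R) i j k (A B C : R) :
  \sum_l f l * (delta R i l * A + delta R j l * B + delta R k l * C)
  = f i * A + f j * B + f k * C.
Proof.
rewrite -(delta_sum f i) -(delta_sum f j) -(delta_sum f k) !mulr_suml -!big_split.
by apply: eq_bigr => l _ /=; ring.
Qed.

(** Contracting with [alt3] picks the six permutations of one component, which
    are equal up to the sign.  It is used to read the torsion form both as a
    combination of basic 3-forms and through its values on a dual frame. *)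
Lemma sum_alt3 F i j k : totally_skew F ->
  \sum_l \sum_m \sum_n F l m n * alt3 i j k l m n = 6 * F i j k.
Proof.
move=> [F12 F23].
have F13 l m n : F l m n = - F n m l by rewrite F12 F23 F12 !opprK.
pose d := delta R.
transitivity (\sum_l \sum_m F l m i * (d j l * d k m - d j m * d k l)
   + \sum_l \sum_m F l m j * (d k l * d i m - d k m * d i l)
   + \sum_l \sum_m F l m k * (d i l * d j m - d i m * d j l)).
  rewrite -!big_split; apply: eq_bigr => l _; rewrite -!big_split.
  apply: eq_bigr => m _ /=; rewrite -delta_sum3.
  by apply: eq_bigr => n _; rewrite /alt3 /d; ring.
have two (f : 'I_5 -> 'I_5 -> R) p q :
    \sum_l \sum_m f l m * (d p l * d q m - d p m * d q l) = f p q - f q p.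
  rewrite -(delta_sum (f^~ q) p) -(delta_sum (f^~ p) q) -sumrB.
  apply: eq_bigr => l _.
  rewrite -(delta_sum (f l) q) -(delta_sum (f l) p) !mulr_suml -sumrB.
  by apply: eq_bigr => m _; rewrite /d; ring.
rewrite !(two (fun l m => F l m _)).
rewrite (F13 k j i) (F23 j k i) (F12 j i k) (F12 k i j) (F23 i k j).
by ring.
Qed.

Lemma totally_skewD F1 F2 (c1 c2 : R) : totally_skew F1 -> totally_skew F2 ->
  totally_skew (fun i j k => c1 * F1 i j k + c2 * F2 i j k).
Proof.
move=> [a1 b1] [a2 b2]; split=> i j k.
  by rewrite a1 a2; ring.
by rewrite b1 b2; ring.
Qed.

Lemma totally_skew_ext F1 F2 : totally_skew F1 -> totally_skew F2 ->
  (forall i j k : 'I_5, (i < j < k)%N -> F1 i j k = F2 i j k) ->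
  forall i j k, F1 i j k = F2 i j k.
Proof.
move=> [a1 b1] [a2 b2] F12.
have z (x : R) : x = - x -> x = 0 by lra.
have lt (i j k : 'I_5) : (i < j)%N -> F1 i j k = F2 i j k.
  move=> ij; have [jk|kj|/val_inj<-] := ltngtP j k.
  - by rewrite F12 ?ij.
  - have [ik|ki|/val_inj<-] := ltngtP i k.
    + by rewrite b1 b2 F12 ?ik.
    + by rewrite b1 b2 a1 a2 F12 ?ki.
    + by rewrite b1 b2 (z _ (a1 i i j)) (z _ (a2 i i j)).
  - by rewrite (z _ (b1 i j j)) (z _ (b2 i j j)).
move=> i j k; have [ij|ji|/val_inj<-] := ltngtP i j; first exact: lt.
  by rewrite a1 a2 lt.
by rewrite (z _ (a1 i i k)) (z _ (a2 i i k)).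
Qed.

Definition normal_torsion (t1 t2 : R) (i j k : 'I_5) : R :=
  t1 * alt3 (ix 1) (ix 2) (ix 4) i j k + t2 * alt3 (ix 1) (ix 3) (ix 5) i j k.

Lemma normal_torsion_skew t1 t2 : totally_skew (normal_torsion t1 t2).
Proof. by apply: totally_skewD; exact: alt3_skew. Qed.

End Alternating.

Section Forms.
Variables (R : realType) (g : vectType R).
Implicit Types (br : g -> g -> g) (h X Y Z : g) (th : 'I_5 -> form1 g).
Implicit Types (al be ga : form1 g) (T : 'I_5 -> 'I_5 -> 'I_5 -> R).

(** The values of a form as elements of the field [R] instead of the module
    [R^o], so that they enter polynomial identities. *)
Definition ev al X : R := al X.

Lemma evB al X Y : ev al (X - Y) = ev al X - ev al Y.
Proof. exact: (linearB (al : 'Hom(g, R^o))). Qed.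
Lemma evD al X Y : ev al (X + Y) = ev al X + ev al Y.
Proof. exact: (linearD (al : 'Hom(g, R^o))). Qed.
Lemma evZ al c X : ev al (c *: X) = c * ev al X.
Proof. exact: (linearZZ (al : 'Hom(g, R^o))). Qed.
Lemma ev0 al : ev al 0 = 0.
Proof. exact: (linear0 (al : 'Hom(g, R^o))). Qed.
Lemma ev_sum al (F : 'I_5 -> g) : ev al (\sum_i F i) = \sum_i ev al (F i).
Proof. exact: (linear_sum (al : 'Hom(g, R^o))). Qed.
Lemma ev_formD al be X : ev (al + be) X = ev al X + ev be X.
Proof. by rewrite /ev lfunE. Qed.
Lemma ev_formZ c al X : ev (c *: al) X = c * ev al X.
Proof. by rewrite /ev lfunE. Qed.
Lemma ev_form_sum (F : 'I_5 -> form1 g) X : ev (\sum_i F i) X = \sum_i ev (F i) X.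
Proof. by rewrite /ev sum_lfunE. Qed.

Lemma wedgeE al be X Y : wedge al be X Y = ev al X * ev be Y - ev al Y * ev be X.
Proof. by []. Qed.

Lemma wedge3E al be ga X Y Z : wedge3 al be ga X Y Z =
  ev al X * (ev be Y * ev ga Z - ev be Z * ev ga Y)
  + ev al Y * (ev be Z * ev ga X - ev be X * ev ga Z)
  + ev al Z * (ev be X * ev ga Y - ev be Y * ev ga X).
Proof. by []. Qed.

Lemma ext_dE br al X Y : ext_d br al X Y = - ev al (br X Y).
Proof. by []. Qed.

Lemma lie_bracketC br X Y : lie_bracket br -> br X Y = - br Y X.
Proof.
move=> L.
have D1 A B Z : br (A + B) Z = br A Z + br B Z.
  by rewrite -[A]scale1r (br_linearl L) !scale1r.
have D2 A B Z : br Z (A + B) = br Z A + br Z B.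
  by rewrite -[A]scale1r (br_linearr L) !scale1r.
have := br_alt L (X + Y).
rewrite D1 !D2 !(br_alt L) addr0 add0r => /eqP.
by rewrite addr_eq0 => /eqP.
Qed.

Lemma lie_bracketN br X Y : lie_bracket br -> br X (- Y) = - br X Y.
Proof.
move=> L; have br0 : br X 0 = 0.
  have := br_linearr L 1 X 0 0; rewrite scaler0 addr0 scale1r => /eqP.
  by rewrite -subr_eq0 opprD addrA subrr sub0r oppr_eq0 => /eqP.
by have := br_linearr L (-1) X Y 0; rewrite !scaleN1r br0 !addr0.
Qed.

Lemma Gamma_ev ga1 ga2 ga3 i j X : ev (Gamma ga1 ga2 ga3 i j) X =
  E1 R i j * ev ga1 X + E2 R i j * ev ga2 X + E3 R i j * ev ga3 X.
Proof. by rewrite /Gamma !ev_formD !ev_formZ. Qed.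

Lemma wedge3_skew th X Y Z :
  totally_skew (fun i j k => wedge3 (th i) (th j) (th k) X Y Z).
Proof. by split=> i j k; rewrite !wedge3E; ring. Qed.

Lemma torsion_form_normal th T t1 t2 :
  (forall i j k, T i j k = normal_torsion t1 t2 i j k) ->
  torsion_normal_form th T t1 t2.
Proof.
move=> HT X Y Z; rewrite /torsion_form.
pose W i j k := wedge3 (th i) (th j) (th k) X Y Z.
have skW : totally_skew W := wedge3_skew th X Y Z.
transitivity (6^-1 * (t1 * (6 * W (ix 1) (ix 2) (ix 4))
                      + t2 * (6 * W (ix 1) (ix 3) (ix 5)))); last by rewrite /W; field.
congr (_ * _); rewrite -!(sum_alt3 _ _ _ skW) !mulr_sumr -big_split.
apply: eq_bigr => i _; rewrite !mulr_sumr -big_split.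
apply: eq_bigr => j _; rewrite !mulr_sumr -big_split.
by apply: eq_bigr => k _; rewrite HT /normal_torsion /W /=; ring.
Qed.

Definition dual_frame th (e : 'I_5 -> g) :=
  forall i j, ev (th i) (e j) = delta R i j.

Lemma wedge3_dual_frame th e i j k l m n : dual_frame th e ->
  wedge3 (th i) (th j) (th k) (e l) (e m) (e n) = alt3 R i j k l m n.
Proof. by move=> de; rewrite wedge3E !de. Qed.

Lemma alt3_sym i j k l m n : alt3 R i j k l m n = alt3 R l m n i j k.
Proof.
have dC p q : delta R p q = delta R q p by rewrite /delta eq_sym.
by rewrite /alt3 !(dC l) !(dC m) !(dC n); ring.
Qed.

(** The components of a 3-form are its values on a dual frame, so a torsion form
    in normal form determines [T] completely. *)
Lemma torsion_normal_dual th T t1 t2 e : dual_frame th e -> totally_skew T ->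
  torsion_normal_form th T t1 t2 ->
  forall i j k, T i j k = normal_torsion t1 t2 i j k.
Proof.
move=> de skT nf i j k; have := nf (e i) (e j) (e k).
rewrite /torsion_form !(wedge3_dual_frame _ _ _ _ _ _ de).
rewrite -/(normal_torsion _ _ _ _ _) => <-.
under eq_bigr => l _ do under eq_bigr => m _ do under eq_bigr => n _ do
  rewrite (wedge3_dual_frame _ _ _ _ _ _ de) alt3_sym.
by rewrite sum_alt3 //; field.
Qed.

(** The coframe maps [g] to a 5-dimensional space with kernel the isotropy line;
    since [g] has dimension 6, this map is onto.  Subtracting a multiple of [h]
    makes the preimages of the basis vectors horizontal for [ga3]. *)
Lemma frame_exists br h U th ga3 : invariant_SO3_structure br h U th ->
  ev ga3 h = 1 ->
  exists e, dual_frame th e /\ forall j, ev ga3 (e j) = 0.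
Proof.
move=> S ga3h; have thh i : ev (th i) h = 0.
  by have [_] := coframe_kernel S h; rewrite memv_line => /(_ isT i).
pose f X := \row_i ev (th i) X.
have flin : linear f.
  by move=> c X Y; apply/rowP=> i; rewrite !mxE evD evZ.
pose fl := linfun (HB.pack_for {linear g -> 'rV[R]_5} f
  (GRing.isLinear.Build _ _ _ _ f flin)).
have flE X : fl X = f X by rewrite lfunE.
have kerf : lker fl = <[h]>%VS.
  apply/vspaceP=> X; apply/idP/idP; rewrite memv_ker flE.
    move/eqP/rowP=> fX; apply/(coframe_kernel S) => i.
    by have := fX i; rewrite !mxE.
  move/(coframe_kernel S) => fX; apply/eqP/rowP=> i; rewrite !mxE; exact: fX.
have imf : limg fl = fullv.
  have := limg_ker_dim fl fullv.
  rewrite capfv kerf dim_vline (isotropy_neq0 S) (group_dim S) => -[].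
  rewrite add0n => dimf.
  by apply/eqP; rewrite eqEdim subvf dimf dimvf.
pose w i := (fl^-1)%VF (delta_mx 0 i).
have wE i j : ev (th i) (w j) = delta R i j.
  have : fl (w j) = delta_mx 0 j by rewrite limg_lfunVK // imf memvf.
  by rewrite flE => /rowP /(_ i); rewrite !mxE.
exists (fun j => w j - ev ga3 (w j) *: h); split=> [i j|j].
  by rewrite evB evZ thh mulr0 subr0 wE.
by rewrite evB evZ ga3h mulr1 subrr.
Qed.

Lemma frame_span br h U th e : invariant_SO3_structure br h U th ->
  dual_frame th e ->
  forall al X, ev al h = 0 -> ev al X = \sum_i ev (th i) X * ev al (e i).
Proof.
move=> S de al X alh.
have /vlineP[c Xc] : X - \sum_i ev (th i) X *: e i \in <[h]>%VS.
  apply/(coframe_kernel S) => i.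
  change (ev (th i) (X - \sum_j ev (th j) X *: e j) = 0).
  rewrite evB ev_sum -[X in _ - X](_ : ev (th i) X = _) ?subrr //.
  rewrite -[LHS](delta_sum (fun j => ev (th j) X)).
  by apply: eq_bigr => j _; rewrite evZ de.
have : ev al (X - \sum_i ev (th i) X *: e i) = 0 by rewrite Xc evZ alh mulr0.
rewrite evB ev_sum => /eqP; rewrite subr_eq0 => /eqP->.
by apply: eq_bigr => i _; rewrite evZ.
Qed.

End Forms.

(** * Structure equations and the reduced connection *)

Section Structure.
Variables (R : realType) (g : vectType R).
Implicit Types (br : g -> g -> g) (h X Y Z : g) (th : 'I_5 -> form1 g).
Implicit Types (al be ga : form1 g) (T : 'I_5 -> 'I_5 -> 'I_5 -> R).

(** The coordinates for the coframe [th 1, ..., th 5, ga3], with one-based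
    indices as in the structure equations. *)
Definition coord th ga3 X (k : nat) : R :=
  if k == 6%N then ev ga3 X else ev (th (ix k)) X.

Lemma coordD th ga3 X Y k :
  coord th ga3 (X + Y) k = coord th ga3 X k + coord th ga3 Y k.
Proof. by rewrite /coord; case: ifP; rewrite evD. Qed.

Lemma coordZ th ga3 c X k : coord th ga3 (c *: X) k = c * coord th ga3 X k.
Proof. by rewrite /coord; case: ifP; rewrite evZ. Qed.

Lemma coord0 th ga3 k : coord th ga3 0 k = 0.
Proof. by rewrite /coord; case: ifP; rewrite ev0. Qed.

Definition minor (p q : nat -> R) (i j : nat) : R := p i * q j - p j * q i.

(** The coordinates of the bracket of two vectors with coordinates [p] and [q],
    i.e. minus the differentials of [th 1, ..., th 5, ga3].  The first five are
    read off the torsion equation; the sixth is dictated by the Jacobi identity,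
    whose coordinate 3 on the triple (2, 4, 5) and coordinate 2 on (3, 4, 5)
    determine the two coefficients. *)
Definition structure (a b t1 t2 : R) (p q : nat -> R) (k : nat) : R :=
  let s := Num.sqrt 3 in
  match k with
  | 1 => - t1 * minor p q 2 4 - (t2 + 2 * s * b) * minor p q 3 5
  | 2 => t1 * minor p q 1 4 - 2 * minor p q 4 6
  | 3 => s * a * minor p q 1 3 + (t2 + s * b) * minor p q 1 5
         - b * minor p q 2 3 + a * minor p q 2 5
         + a * minor p q 3 4 - b * minor p q 4 5 - minor p q 5 6
  | 4 => - t1 * minor p q 1 2 + 2 * minor p q 2 6
  | 5 => - (t2 + s * b) * minor p q 1 3 + s * a * minor p q 1 5
         + a * minor p q 2 3 + b * minor p q 2 5
         + b * minor p q 3 4 + a * minor p q 4 5 + minor p q 3 6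
  | _ => (2 * (a ^+ 2 + b ^+ 2) + s * b * t1 + t1 * t2) * minor p q 2 4
         + (s * b * t1 + t1 * t2 / 2) * minor p q 3 5
  end.

Lemma torsion_structure a b t1 t2 th ga1 ga2 ga3 T X Y k : (0 < k <= 5)%N ->
  connection_normal_form th ga1 ga2 a b ->
  (forall i j k, T i j k = normal_torsion t1 t2 i j k) ->
  \sum_j wedge (Gamma ga1 ga2 ga3 (ix k) j) (th j) X Y
  - 2^-1 * (\sum_i \sum_j T (ix k) i j * wedge (th i) (th j) X Y)
  = structure a b t1 t2 (coord th ga3 X) (coord th ga3 Y) k.
Proof.
move=> k5 [g1 g2] HT.
have e1 Z : ev ga1 Z = - b * ev (th (ix 3)) Z + a * ev (th (ix 5)) Z.
  by rewrite g1 ev_formD !ev_formZ.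
have e2 Z : ev ga2 Z = a * ev (th (ix 3)) Z + b * ev (th (ix 5)) Z.
  by rewrite g2 ev_formD !ev_formZ.
have GE i j Z := Gamma_ev ga1 ga2 ga3 i j Z.
move: (E1 R) (E2 R) (E3 R) (E1_entry R) (E2_entry R) (E3_entry R) GE.
move=> M1 M2 M3 H1 H2 H3 GE.
have wE al be := wedgeE al be X Y.
rewrite /structure /minor /coord /=.
rewrite !big_ix !wE !GE !e1 !e2 {wE GE e1 e2 g1 g2}.
rewrite !HT /normal_torsion /alt3.
case: k k5 => [|[|[|[|[|[|k]]]]]] // _; rewrite !H1 // !H2 // !H3 // !delta_ix //=.
all: by field.
Qed.

Section ReducedConnection.
Variables (br : g -> g -> g) (h : g) (U : 'I_5 -> 'I_5 -> 'I_5 -> R).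
Variables (th : 'I_5 -> form1 g) (ga1 ga2 ga3 : form1 g).
Variable (T : 'I_5 -> 'I_5 -> 'I_5 -> R).
Hypothesis S : invariant_SO3_structure br h U th.
Hypothesis C : characteristic_connection br h th ga1 ga2 ga3 T.

Lemma coframe_isotropy i : ev (th i) h = 0.
Proof. by have [_] := coframe_kernel S h; rewrite memv_line => /(_ isT i). Qed.

Lemma connection_isotropy : [/\ ev ga1 h = 0, ev ga2 h = 0 & ev ga3 h = 1].
Proof.
have s0 := sqrt3_neq0 R.
have iso i j : E1 R i j * ev ga1 h + E2 R i j * ev ga2 h + E3 R i j * ev ga3 h
    = E3 R i j by rewrite -Gamma_ev; exact: Gamma_isotropy C i j.
(* the entries (1, 5), (1, 3) and (2, 4) isolate the three components *)
move: (iso (ix 1) (ix 5)) (iso (ix 1) (ix 3)) (iso (ix 2) (ix 4)) => {iso}.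
rewrite !E1_entry // !E2_entry // !E3_entry // /= !mul0r !addr0 !add0r.
move=> /eqP; rewrite mulf_eq0 (negPf s0) => /eqP-> /eqP.
rewrite mulf_eq0 (negPf s0) => /eqP-> h3; split=> //; lra.
Qed.

Lemma Gamma_isotropyE i j : ev (Gamma ga1 ga2 ga3 i j) h = E3 R i j.
Proof. exact: Gamma_isotropy C i j. Qed.

(** The torsion equation contracted with [h]: the torsion is horizontal and
    [Gamma] takes the value [E3] on [h]. *)
Lemma coframe_equivariant i X : ev (th i) (br h X) = \sum_j E3 R i j * ev (th j) X.
Proof.
have := torsion_eq C i h X; rewrite ext_dE.
rewrite [X in _ = X](_ : _ = 0); last first.
  rewrite big1 ?mulr0 // => j _; rewrite big1 // => k _.
  by rewrite wedgeE !coframe_isotropy; ring.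
under eq_bigr => j _ do rewrite wedgeE coframe_isotropy mulr0 subr0 Gamma_isotropyE.
by move=> /eqP; rewrite addrC subr_eq0 => /eqP->.
Qed.

Lemma connection_equivariant X :
  ev ga1 (br h X) = - ev ga2 X /\ ev ga2 (br h X) = ev ga1 X.
Proof.
have s0 := sqrt3_neq0 R.
have eqv i j : ev (Gamma ga1 ga2 ga3 i j) (br h X) =
    \sum_k (E3 R i k * ev (Gamma ga1 ga2 ga3 k j) X
            - ev (Gamma ga1 ga2 ga3 i k) X * E3 R k j).
  exact: Gamma_equivariant C i j X.
have GE i j Z := Gamma_ev ga1 ga2 ga3 i j Z.
move: (eqv (ix 1) (ix 5)) (eqv (ix 1) (ix 3)); rewrite {eqv} !big_ix !GE {GE}.
move: (E1 R) (E2 R) (E3 R) (E1_entry R) (E2_entry R) (E3_entry R).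
move=> M1 M2 M3 H1 H2 H3.
rewrite !H1 // !H2 // !H3 //= => h15 h13.
by split; apply: (mulfI s0); lra.
Qed.

(** The horizontal pair [ga1, ga2] has weight 1 for the rotation by [E3].  Its
    components on the weight 0 line and the weight 2 plane therefore vanish, and
    on the weight 1 plane it commutes with the rotation: two parameters. *)
Lemma connection_normal : exists a b, connection_normal_form th ga1 ga2 a b.
Proof.
have [g1h g2h g3h] := connection_isotropy.
have [e [de e3]] := frame_exists S g3h.
have span al X : ev al h = 0 -> _ := frame_span S de X.
have sp1 X := span ga1 X g1h; have sp2 X := span ga2 X g2h.
have br_e al j : ev al h = 0 ->
    ev al (br h (e j)) = \sum_i E3 R i j * ev al (e i).
  move=> alh; rewrite (span al _ alh); apply: eq_bigr => i _; congr (_ * _).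
  rewrite coframe_equivariant -[RHS](delta_sum (E3 R i) j).
  by apply: eq_bigr => k _; rewrite de /delta eq_sym.
have onbr j : ev ga2 (e j) = - \sum_i E3 R i j * ev ga1 (e i) /\
              ev ga1 (e j) = \sum_i E3 R i j * ev ga2 (e i).
  have [eq1 eq2] := connection_equivariant (e j).
  by rewrite -(br_e ga1) // -(br_e ga2) // eq1 eq2 opprK.
exists (ev ga1 (e (ix 5))), (ev ga2 (e (ix 5))).
move: (onbr (ix 1)) (onbr (ix 2)) (onbr (ix 3)) (onbr (ix 4)) (onbr (ix 5)).
rewrite !big_ix {onbr}.
move: (E3 R) (E3_entry R) => M HM; rewrite !HM //=.
move=> [p1 q1] [p2 q2] [p3 q3] [p4 q4] [p5 q5].
split; apply/lfunP=> X.
  change (ev ga1 X = ev (- ev ga2 (e (ix 5)) *: th (ix 3)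
                         + ev ga1 (e (ix 5)) *: th (ix 5)) X).
  rewrite sp1 ev_formD !ev_formZ big_ix.
  have -> : ev ga1 (e (ix 1)) = 0 by lra.
  have -> : ev ga1 (e (ix 2)) = 0 by lra.
  have -> : ev ga1 (e (ix 4)) = 0 by lra.
  have -> : ev ga1 (e (ix 3)) = - ev ga2 (e (ix 5)) by lra.
  by ring.
change (ev ga2 X = ev (ev ga1 (e (ix 5)) *: th (ix 3)
                       + ev ga2 (e (ix 5)) *: th (ix 5)) X).
rewrite sp2 ev_formD !ev_formZ big_ix.
have -> : ev ga2 (e (ix 1)) = 0 by lra.
have -> : ev ga2 (e (ix 2)) = 0 by lra.
have -> : ev ga2 (e (ix 4)) = 0 by lra.
have -> : ev ga2 (e (ix 3)) = ev ga1 (e (ix 5)) by lra.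
by ring.
Qed.

Lemma torsion_skew : totally_skew T.
Proof. by split; [exact: torsion_skew12 C | exact: torsion_skew23 C]. Qed.

End ReducedConnection.
End Structure.

(** * Invariance of the torsion *)

Section TorsionInvariance.
Variables (R : realType) (g : vectType R).
Variables (br : g -> g -> g) (h : g) (U : 'I_5 -> 'I_5 -> 'I_5 -> R).
Variables (th : 'I_5 -> form1 g) (ga1 ga2 ga3 : form1 g).
Variable (T : 'I_5 -> 'I_5 -> 'I_5 -> R).
Hypothesis S : invariant_SO3_structure br h U th.
Hypothesis C : characteristic_connection br h th ga1 ga2 ga3 T.

Let thv X : 'cV[R]_5 := \col_i ev (th i) X.
Let G X : 'M[R]_5 := \matrix_(i, j) ev (Gamma ga1 ga2 ga3 i j) X.
Let tor (u v : 'cV[R]_5) : 'cV[R]_5 :=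
  \col_i \sum_j \sum_k T i j k * u j 0 * v k 0.

(** Matrix form of the torsion equation; skewness of [T] in its last two indices
    absorbs the factor 1/2. *)
Lemma bracket_torsion X Y :
  thv (br X Y) = G X *m thv Y - G Y *m thv X - tor (thv X) (thv Y).
Proof.
apply/matrixP=> i j; rewrite {j}ord1 !mxE.
have := torsion_eq C i X Y; rewrite ext_dE.
have -> : 2^-1 * (\sum_j \sum_k T i j k * wedge (th j) (th k) X Y)
    = \sum_j \sum_k T i j k * thv X j 0 * thv Y k 0.
  have half : \sum_j \sum_k T i j k * (ev (th j) Y * ev (th k) X) =
      - \sum_j \sum_k T i j k * (ev (th j) X * ev (th k) Y).
    rewrite exchange_big -sumrN; apply: eq_bigr => j _; rewrite -sumrN.
    apply: eq_bigr => k _; rewrite (torsion_skew23 C); ring.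
  transitivity (2^-1 * (\sum_j \sum_k T i j k * (ev (th j) X * ev (th k) Y)
                  - \sum_j \sum_k T i j k * (ev (th j) Y * ev (th k) X))).
    congr (_ * _); rewrite -sumrB; apply: eq_bigr => j _; rewrite -sumrB.
    by apply: eq_bigr => k _; rewrite wedgeE; ring.
  rewrite half opprK; set Q := bigop.body _ _ _.
  transitivity Q; first by field.
  by apply: eq_bigr => j _; apply: eq_bigr => k _; rewrite !mxE mulrA.
have -> : \sum_j wedge (Gamma ga1 ga2 ga3 i j) (th j) X Y =
    \sum_j G X i j * thv Y j 0 - \sum_j G Y i j * thv X j 0.
  by rewrite -sumrB; apply: eq_bigr => j _; rewrite wedgeE !mxE.
lra.
Qed.

(** Bracketing with [h] is a derivation, and it acts on [th] and [Gamma] through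
    [E3]; the terms of [bracket_torsion] that involve [Gamma] cancel, and what
    is left says that [E3] preserves the torsion. *)
Lemma torsion_equivariant X Y :
  E3 R *m tor (thv X) (thv Y)
  = tor (E3 R *m thv X) (thv Y) + tor (thv X) (E3 R *m thv Y).
Proof.
have cE := coframe_equivariant S C.
have gE : forall i j Z, ev (Gamma ga1 ga2 ga3 i j) (br h Z) = \sum_k
    (E3 R i k * ev (Gamma ga1 ga2 ga3 k j) Z
     - ev (Gamma ga1 ga2 ga3 i k) Z * E3 R k j) := Gamma_equivariant C.
move: (E3 R) cE gE => M cE gE.
have thh Z : thv (br h Z) = M *m thv Z.
  apply/matrixP=> i j; rewrite !mxE cE.
  by apply: eq_bigr => k _; rewrite mxE.
have Gh Z : G (br h Z) = M *m G Z - G Z *m M.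
  apply/matrixP=> i j; rewrite !mxE -sumrB gE; apply: eq_bigr => k _.
  by rewrite !mxE.
have jac : thv (br h (br X Y)) = thv (br (br h X) Y) + thv (br X (br h Y)).
  have L := group_bracket S; have := br_jacobi L h X Y.
  rewrite (lie_bracketC Y h L) (lie_bracketN _ _ L) (lie_bracketC Y (br h X) L).
  move=> J; apply/matrixP=> i j; rewrite !mxE -evD.
  by congr (ev _ _); apply/eqP; rewrite -subr_eq0 opprD addrA addrAC J.
move: jac; rewrite thh (bracket_torsion X Y) (bracket_torsion (br h X) Y).
rewrite (bracket_torsion X (br h Y)) !thh !Gh.
rewrite !mulmxBr !mulmxBl !mulmxA => J.
apply/matrixP => i j; move/matrixP/(_ i j): J.
rewrite !mxE; lra.
Qed.

Lemma torsion_invariant i j k :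
  \sum_l E3 R i l * T l j k = \sum_l T i l k * E3 R l j + \sum_l T i j l * E3 R l k.
Proof.
have [_ _ g3h] := connection_isotropy C.
have [e [de _]] := frame_exists S g3h.
have thve m : thv (e m) = delta_mx m 0.
  by apply/matrixP=> p q; rewrite !mxE de ord1 eqxx andbT.
have tor_delta (u v : 'cV[R]_5) p :
    tor u v p 0 = \sum_q (\sum_r T p q r * v r 0) * u q 0.
  rewrite mxE; apply: eq_bigr => q _; rewrite mulr_suml.
  by apply: eq_bigr => r _; rewrite mulrAC.
have dm (m l : 'I_5) : (delta_mx m 0 : 'cV[R]_5) l 0 = delta R m l.
  by rewrite mxE eqxx andbT /delta eq_sym.
have mcol (M : 'M[R]_5) (m l : 'I_5) : (M *m (delta_mx m 0 : 'cV[R]_5)) l 0 = M l m.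
  by rewrite -colE mxE.
have := torsion_equivariant (e j) (e k); rewrite !thve.
move: (E3 R) => M /matrixP /(_ i 0); rewrite [LHS]mxE [RHS]mxE !tor_delta => J.
transitivity (\sum_l M i l * tor (delta_mx j 0) (delta_mx k 0) l 0).
  apply: eq_bigr => l _; rewrite tor_delta -[in LHS](delta_sum (fun q => T l q k) j).
  congr (_ * _); apply: eq_bigr => q _; rewrite dm; congr (_ * _).
  by rewrite -[LHS](delta_sum (T l q) k); apply: eq_bigr => r _; rewrite dm.
rewrite J; congr (_ + _).
  apply: eq_bigr => q _; rewrite mcol; congr (_ * _).
  by rewrite -[RHS](delta_sum (T i q) k); apply: eq_bigr => r _; rewrite dm.
under eq_bigr => q _ do rewrite dm.
by rewrite delta_sum; apply: eq_bigr => r _; rewrite mcol.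
Qed.

(** The eight components other than [T 1 2 4] and [T 1 3 5] have nonzero weights
    for the rotation, so invariance couples them in systems with only the zero
    solution. *)
Lemma torsion_normal :
  exists t1 t2, forall i j k, T i j k = normal_torsion t1 t2 i j k.
Proof.
exists (T (ix 1) (ix 2) (ix 4)), (T (ix 1) (ix 3) (ix 5)).
have [T12 T23] := torsion_skew C.
have z (x : R) : x = - x -> x = 0 by lra.
have Tii i j : T i i j = 0 by apply: z; rewrite {1}T12.
have Tjj i j : T i j j = 0 by apply: z; rewrite {1}T23.
have Tik i j : T i j i = 0 by rewrite T12 Tjj oppr0.
have D i j k := torsion_invariant (ix i) (ix j) (ix k).
move: (D 1 2 3)%N (D 1 4 5)%N (D 1 2 5)%N (D 1 4 3)%N (D 2 3 4)%N (D 2 4 5)%N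
  (D 2 3 5)%N (D 4 3 5)%N => {D}.
rewrite !big_ix; move: (E3 R) (E3_entry R) => M HM; rewrite !HM // {M HM} /=.
rewrite !Tii !Tjj !Tik !(mulr0, mul0r, addr0, add0r, mulr1, mul1r).
have := (T23 (ix 1) (ix 4) (ix 3), T23 (ix 1) (ix 4) (ix 2)).
have := (T23 (ix 2) (ix 5) (ix 4), T23 (ix 2) (ix 4) (ix 3)).
have := (T12 (ix 4) (ix 3) (ix 5), T12 (ix 3) (ix 2) (ix 5)).
have := T23 (ix 1) (ix 3) (ix 2).
move=> ? [? ?] [? ?] [? ?] *.
apply: totally_skew_ext; first exact: torsion_skew C.
  exact: normal_torsion_skew.
move=> i j k; elim/ord5_ind: i; elim/ord5_ind: j; rewrite ?val_ix //= ?ltnn //=.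
all: elim/ord5_ind: k; rewrite ?val_ix //= => _.
all: rewrite /normal_torsion /alt3 !delta_ix //=.
all: lra.
Qed.

End TorsionInvariance.

(** * The quadratic relations between the parameters *)

Section QuadraticRelations.
Variables (R : realType) (g : vectType R).
Variables (br : g -> g -> g) (h : g) (U : 'I_5 -> 'I_5 -> 'I_5 -> R).
Variables (th : 'I_5 -> form1 g) (ga1 ga2 ga3 : form1 g).
Variable (T : 'I_5 -> 'I_5 -> 'I_5 -> R).
Hypothesis S : invariant_SO3_structure br h U th.
Hypothesis C : characteristic_connection br h th ga1 ga2 ga3 T.
Variables (a b t1 t2 : R).
Hypothesis Ht : torsion_normal_form th T t1 t2.
Hypothesis Hc : connection_normal_form th ga1 ga2 a b.

Lemma coord_bracket X Y k : (0 < k <= 5)%N ->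
  coord th ga3 (br X Y) k
  = structure a b t1 t2 (coord th ga3 X) (coord th ga3 Y) k.
Proof.
move=> k5; have [_ _ g3h] := connection_isotropy C.
have [e [de _]] := frame_exists S g3h.
have HT := torsion_normal_dual de (torsion_skew C) Ht.
rewrite -(torsion_structure ga3 X Y k5 Hc HT) -(torsion_eq C) ext_dE.
rewrite /coord; case: eqP k5 => [->//|_ _].
by rewrite opprD opprK addrCA subrr addr0.
Qed.

(** Each relation is one coordinate of the Jacobi identity on a triple for which
    the [h]-components of the brackets do not contribute: coordinate 3 on
    (2, 3, 4), coordinate 5 on (1, 2, 5) and on (1, 4, 5), and coordinate 1 on
    (1, 3, 5). *)
Lemma structure_relations :
  [/\ a * t1 = 0, a * (t1 - 2 * t2 - 2 * (Num.sqrt 3 * b)) = 0,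
      b * (t1 - 2 * t2 - 2 * (Num.sqrt 3 * b)) = 0
    & a * (6 * b + Num.sqrt 3 * t2) = 0].
Proof.
have sq3 := sqrt3 R.
have s0 := sqrt3_neq0 R.
have [_ _ g3h] := connection_isotropy C.
have [e [de e3]] := frame_exists S g3h.
pose c := coord th ga3.
have cB := coord_bracket.
have cD X Y k : c (X + Y) k = c X k + c Y k by exact: coordD.
have c0 k : c 0 k = 0 by exact: coord0.
have ce m k : (0 < m <= 5)%N -> (0 < k <= 5)%N -> c (e (ix m)) k = (k == m)%:R.
  move=> m5 k5; rewrite /c /coord; case: eqP k5 => [->//|_ k5].
  by rewrite de delta_ix.
have ce6 m : c (e m) 6%N = 0 by rewrite /c /coord e3.
have J X Y Z k : (0 < k <= 5)%N ->
    structure a b t1 t2 (c X) (c (br Y Z)) k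
    + structure a b t1 t2 (c Y) (c (br Z X)) k
    + structure a b t1 t2 (c Z) (c (br X Y)) k = 0.
  by move=> k5; rewrite -!cB // -!cD (br_jacobi (group_bracket S)) c0.
move: cB; rewrite -/c => cB; move: c cB cD c0 ce ce6 J => c cB _ _ ce ce6 J.
have := J (e (ix 1)) (e (ix 3)) (e (ix 5)) 1%N isT.
have := J (e (ix 1)) (e (ix 4)) (e (ix 5)) 5%N isT.
have := J (e (ix 1)) (e (ix 2)) (e (ix 5)) 5%N isT.
have := J (e (ix 2)) (e (ix 3)) (e (ix 4)) 3%N isT.
(* the sixth coordinate of a bracket is unknown and must not be rewritten *)
have cBs X Y := (cB X Y 1%N isT, cB X Y 2%N isT, cB X Y 3%N isT, cB X Y 4%N isT,
  cB X Y 5%N isT).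
rewrite /structure /minor !cBs /structure /minor.
rewrite !ce6 !ce //= => j1 j2 j3 j4.
have n2 : 2 != 0 :> R by rewrite pnatr_eq0.
split; [apply: (mulfI s0)| | |apply: (mulfI n2)]; rewrite ?mulr0.
- by rewrite -[RHS]oppr0 -[X in _ = - X]j1; ring.
- by rewrite -[RHS]j2; ring: sq3.
- by rewrite -[RHS]oppr0 -[X in _ = - X]j3; ring: sq3.
- by rewrite -[RHS]j4; ring: sq3.
Qed.

Lemma parameter_families :
  [\/ [/\ b = 0, t1 = 0 & t2 = 0],
      a = 0 /\ b = 0
    | a = 0 /\ b = (t1 - 2 * t2) / (2 * Num.sqrt 3)].
Proof.
have sq3 := sqrt3 R.
have s0 := sqrt3_neq0 R.
have [r1 r2 r3 r4] := structure_relations.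
have [a0|a0] := eqVneq a 0.
  have [b0|b0] := eqVneq b 0; first exact: Or32.
  apply: Or33; split=> //; move/(mulfI b0): (etrans r3 (esym (mulr0 b))).
  move/eqP; rewrite subr_eq0 => /eqP->; by field; rewrite s0.
have cancel x : a * x = 0 -> x = 0 by move=> ax; apply: (mulfI a0); rewrite mulr0.
have t10 := cancel _ r1.
have t2b : t2 = - (Num.sqrt 3 * b) by have := cancel _ r2; rewrite t10; lra.
have b0 : b = 0.
  have := cancel _ r4; rewrite t2b mulrN mulrA sq3; lra.
by apply: Or31; split; rewrite // t2b b0 mulr0 oppr0.
Qed.


End QuadraticRelations.

(** * Nearly integrable structures from a characteristic connection *)

Section NearlyIntegrable.
Variables (R : realType) (g : vectType R).
Variables (br : g -> g -> g) (h : g).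
Variables (th : 'I_5 -> form1 g) (ga1 ga2 ga3 : form1 g).
Variable (T : 'I_5 -> 'I_5 -> 'I_5 -> R).
Hypothesis C : characteristic_connection br h th ga1 ga2 ga3 T.

(** Adding half of the torsion to [Gamma] removes the torsion, and the skewness
    of [T] in its first two indices keeps the connection metric. *)
Definition levi_civita_form (i j : 'I_5) : form1 g :=
  Gamma ga1 ga2 ga3 i j + 2^-1 *: \sum_k T i j k *: th k.

Lemma levi_civita_formE i j X :
  ev (levi_civita_form i j) X =
  ev (Gamma ga1 ga2 ga3 i j) X + 2^-1 * \sum_k T i j k * ev (th k) X.
Proof.
rewrite ev_formD ev_formZ ev_form_sum; congr (_ + _ * _).
by apply: eq_bigr => k _; rewrite ev_formZ.
Qed.

Lemma Gamma_skew i j X :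
  ev (Gamma ga1 ga2 ga3 i j) X = - ev (Gamma ga1 ga2 ga3 j i) X.
Proof. by rewrite !Gamma_ev E1_skew E2_skew E3_skew; ring. Qed.

Lemma levi_civita_torsion : levi_civita br th levi_civita_form.
Proof.
split=> [i j|i X Y].
  apply/lfunP=> X; rewrite opp_lfunE.
  change (ev (levi_civita_form i j) X = - ev (levi_civita_form j i) X).
  rewrite !levi_civita_formE Gamma_skew opprD -mulrN -sumrN.
  congr (_ + _ * _); apply: eq_bigr => k _.
  by rewrite (torsion_skew12 C) mulNr.
have := torsion_eq C i X Y.
rewrite [X in _ = X](_ : _ = - \sum_j wedge (2^-1 *: \sum_k T i j k *: th k) (th j) X Y).
  move=> /eqP; rewrite -subr_eq0 opprK -addrA -big_split => /eqP {2}<-.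
  congr (_ + _); apply: eq_bigr => j _.
  by rewrite /= !wedgeE !ev_formD; ring.
rewrite mulr_sumr -sumrN; apply: eq_bigr => j _.
rewrite wedgeE !ev_formZ !ev_form_sum.
transitivity (2^-1 * (ev (th j) X * (\sum_k T i j k * ev (th k) Y)
                     - ev (th j) Y * \sum_k T i j k * ev (th k) X)).
  congr (_ * _); rewrite !mulr_sumr -sumrB; apply: eq_bigr => k _.
  by rewrite wedgeE; ring.
under [X in _ = - (_ * X * _ - _)]eq_bigr => k _ do rewrite ev_formZ.
under [X in _ = - (_ - _ * X * _)]eq_bigr => k _ do rewrite ev_formZ.
by ring.
Qed.

Lemma torsion_contract i (x : 'I_5 -> R) :
  \sum_j \sum_k T i j k * x j * x k = 0.
Proof.
apply/eqP; rewrite -[_ == 0](mulrn_eq0 _ 2) mulr2n {2}exchange_big -big_split.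
apply/eqP/big1 => k _; rewrite -big_split; apply/big1 => l _ /=.
by rewrite (torsion_skew23 C i l k); ring.
Qed.

(** On the diagonal the derivative of [Upsilon] is minus three times the
    polarized cubic at [(x, x, y)], with [y] the image of [x = th X] under the Levi-Civita
    form at [X].  The torsion part of [y] is zero, and its remaining part lies
    in the span of [E1 x, E2 x, E3 x], where the cubic is invariant. *)
Lemma characteristic_nearly_integrable : nearly_integrable br (adapted_tensor R) th.
Proof.
exists levi_civita_form; split; first exact: levi_civita_torsion.
move=> X; pose x i := ev (th i) X.
pose om i j := ev (levi_civita_form i j) X.
pose y l := \sum_i om l i * x i.
have yE l : y l = act (E1 R) x l * ev ga1 X + act (E2 R) x l * ev ga2 X
                  + act (E3 R) x l * ev ga3 X.
  rewrite /y /act !mulr_suml -!big_split /= -[RHS]addr0.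
  rewrite -[X in _ = _ + X](mulr0 2^-1) -[X in _ = _ + _ * X](torsion_contract l x).
  rewrite mulr_sumr -big_split.
  apply: eq_bigr => i _; rewrite /= /om levi_civita_formE Gamma_ev.
  rewrite mulrDl -[2^-1 * _ * _]mulrA [in LHS]mulr_suml; congr (_ + _); first by ring.
  by congr (_ * _); apply: eq_bigr => k _; rewrite /x; ring.

have P3 : \sum_i \sum_j \sum_k (\sum_l om l k * adapted_tensor R i j l) * x i * x j * x k
    = polar_cubic x x y.
  rewrite -adapted_tensor_sum3; apply: eq_bigr => i _; apply: eq_bigr => j _.
  transitivity (x i * x j * \sum_k \sum_l om l k * adapted_tensor R i j l * x k).
    rewrite mulr_sumr; apply: eq_bigr => k _.
    by rewrite -mulr_suml; ring.
  rewrite exchange_big mulr_sumr; apply: eq_bigr => l _ /=.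
  rewrite /y !mulr_sumr; apply: eq_bigr => k _; ring.
have P2 : \sum_i \sum_j \sum_k (\sum_l om l j * adapted_tensor R i l k) * x i * x j * x k
    = polar_cubic x x y.
  rewrite -P3; apply: eq_bigr => i _; rewrite exchange_big.
  apply: eq_bigr => j _; apply: eq_bigr => k _; rewrite /= mulrAC.
  by do 3!congr (_ * _); apply: eq_bigr => l _; rewrite /adapted_tensor polar_sym23.
have P1 : \sum_i \sum_j \sum_k (\sum_l om l i * adapted_tensor R l j k) * x i * x j * x k
    = polar_cubic x x y.
  rewrite -P2 exchange_big; apply: eq_bigr => i _; apply: eq_bigr => j _.
  apply: eq_bigr => k _; rewrite /= [_ * x j * x i]mulrAC.
  by do 3!congr (_ * _); apply: eq_bigr => l _; rewrite /adapted_tensor polar_sym12.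
transitivity (- (polar_cubic x x y + polar_cubic x x y + polar_cubic x x y)).
  rewrite -[in X in X + _ + _]P1 -[in X in _ + X + _]P2 -[in X in _ + X]P3.
  rewrite -!big_split -sumrN; apply: eq_bigr => i _.
  rewrite -!big_split -sumrN; apply: eq_bigr => j _.
  rewrite -!big_split -sumrN; apply: eq_bigr => k _.
  rewrite /nabla_Upsilon !big_split /=.
  change (- (\sum_l om l i * adapted_tensor R l j k
            + \sum_l om l j * adapted_tensor R i l k
            + \sum_l om l k * adapted_tensor R i j l) * x i * x j * x k =
    - ((\sum_l om l i * adapted_tensor R l j k) * x i * x j * x k
     + (\sum_l om l j * adapted_tensor R i l k) * x i * x j * x k
     + (\sum_l om l k * adapted_tensor R i j l) * x i * x j * x k)).
  by ring.
have -> : polar_cubic x x y = 0.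
  rewrite (polar_comb3 _ _ yE) (polar_invariant_diag (polar_E1 x x x)).
  rewrite (polar_invariant_diag (polar_E2 x x x)) (polar_invariant_diag (polar_E3 x x x)).
  by rewrite !mul0r !addr0.
by rewrite !addr0 oppr0.
Qed.

End NearlyIntegrable.

(** * The six-dimensional models *)

Section Jacobi.
Variable R : realType.
Implicit Types (a b : R) (p q r : nat -> R).

Lemma structure_ext a b (t1 t2 : R) p p' q q' k :
  (forall i, (0 < i <= 6)%N -> p i = p' i) ->
  (forall i, (0 < i <= 6)%N -> q i = q' i) ->
  structure a b t1 t2 p q k = structure a b t1 t2 p' q' k.
Proof.
move=> pp qq; rewrite /structure /minor.
rewrite !(pp 1%N isT, pp 2%N isT, pp 3%N isT, pp 4%N isT, pp 5%N isT, pp 6%N isT).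
by rewrite !(qq 1%N isT, qq 2%N isT, qq 3%N isT, qq 4%N isT, qq 5%N isT, qq 6%N isT).
Qed.

Lemma structure_linearl a b (t1 t2 c : R) p p' q k :
  structure a b t1 t2 (fun i => c * p i + p' i) q k
  = c * structure a b t1 t2 p q k + structure a b t1 t2 p' q k.
Proof.
by rewrite /structure /minor; case: k => [|[|[|[|[|[|k]]]]]]; field.
Qed.

Lemma structureC a b (t1 t2 : R) p q k :
  structure a b t1 t2 p q k = - structure a b t1 t2 q p k.
Proof.
by rewrite /structure /minor; case: k => [|[|[|[|[|[|k]]]]]]; field.
Qed.

Definition family a b (t1 t2 : R) :=
  [\/ [/\ b = 0, t1 = 0 & t2 = 0],
      a = 0 /\ b = 0
    | a = 0 /\ b = (t1 - 2 * t2) / (2 * Num.sqrt 3)].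

(** Substituting the equations of a family makes the identity polynomial, up to
    the relation [s * s = 3]. *)
Lemma structure_jacobi a b (t1 t2 : R) p q r k : family a b t1 t2 ->
  (0 < k <= 6)%N ->
  structure a b t1 t2 p (structure a b t1 t2 q r) k
  + structure a b t1 t2 q (structure a b t1 t2 r p) k
  + structure a b t1 t2 r (structure a b t1 t2 p q) k = 0.
Proof.
have sq3 := sqrt3 R.
have s0 := sqrt3_neq0 R.
rewrite /family /structure /minor; move: (Num.sqrt 3) sq3 s0 => s sq3 s0.
case=> [[-> -> ->]|[-> ->]|[-> b_eq]].

- case: k => [|[|[|[|[|[|[|k]]]]]]] // _; by field: sq3.
- case: k => [|[|[|[|[|[|[|k]]]]]]] // _; by field: sq3.
(* solving for [t1] instead of [b] avoids denominators *)
have -> : t1 = 2 * (s * b) + 2 * t2 by rewrite b_eq; field.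
case: k => [|[|[|[|[|[|[|k]]]]]]] // _; by field: sq3.
Qed.

End Jacobi.

Section Model.
Variable R : realType.

Definition row_entry (k : 'I_6) (X : 'rV[R]_6) : R^o := X 0 k.

Lemma row_entry_linear k : linear (row_entry k).
Proof. by move=> c X Y; rewrite /row_entry !mxE. Qed.

HB.instance Definition _ k :=
  GRing.isLinear.Build R 'rV[R]_6 R^o _ (row_entry k) (row_entry_linear k).

Variables (a b t1 t2 : R).
Local Notation g := ('rV[R]_6 : vectType R).

Definition entry_form (k : 'I_6) : form1 g := linfun (row_entry k).

Lemma entry_formE k (X : g) : ev (entry_form k) X = X 0 k.
Proof. by rewrite /ev lfunE. Qed.

Definition model_th (i : 'I_5) : form1 g := entry_form (widen_ord (leqnSn 5) i).
Definition model_ga3 : form1 g := entry_form ord_max.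
Definition model_ga1 : form1 g := - b *: model_th (ix 3) + a *: model_th (ix 5).
Definition model_ga2 : form1 g := a *: model_th (ix 3) + b *: model_th (ix 5).
Definition model_h : g := delta_mx 0 ord_max.

Local Notation model_coord := (coord model_th model_ga3).

Lemma model_coordE (X : g) (k : 'I_6) : model_coord X k.+1 = X 0 k.
Proof.
rewrite /coord eqSS; case: eqP => [k5|k5].
  by rewrite entry_formE; congr (X 0 _); apply: val_inj.
rewrite entry_formE; congr (X 0 _); apply: val_inj => /=.
have := ltn_ord k; rewrite ltnS leq_eqVlt => /orP[/eqP //|k5'].
by rewrite val_ix.
Qed.

Lemma model_coord_ext (X Y : g) :
  (forall k, (0 < k <= 6)%N -> model_coord X k = model_coord Y k) -> X = Y.
Proof.
move=> XY; apply/rowP=> k; rewrite -!model_coordE; apply: XY.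
exact: ltn_ord.
Qed.

Definition model_br (X Y : g) : g :=
  \row_(k < 6) structure a b t1 t2 (model_coord X) (model_coord Y) k.+1.

Lemma model_coord_br X Y k : (0 < k <= 6)%N ->
  model_coord (model_br X Y) k
  = structure a b t1 t2 (model_coord X) (model_coord Y) k.
Proof.
by case: k => // k k6; rewrite (model_coordE _ (Ordinal (k6 : (k < 6)%N))) mxE.
Qed.

Lemma model_brN X Y : model_br X Y = - model_br Y X.
Proof. by apply/rowP=> k; rewrite !mxE structureC. Qed.

Lemma model_br_linearl (c : R) X Y Z :
  model_br (c *: X + Y) Z = c *: model_br X Z + model_br Y Z.
Proof.
apply/rowP=> k; rewrite !mxE -structure_linearl; apply: structure_ext => // i _.
by rewrite coordD coordZ.
Qed.

Hypothesis Hfam : family a b t1 t2.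

Lemma model_lie_bracket : lie_bracket model_br.
Proof.
split=> [c X Y Z|c X Y Z|X|X Y Z].
- exact: model_br_linearl.
- by rewrite ![model_br X _]model_brN model_br_linearl scalerN opprD.
- apply/rowP=> k; rewrite !mxE; set x := structure _ _ _ _ _ _ _.
  by have : x = - x by [exact: structureC]; lra.
- apply: model_coord_ext => k k6; rewrite coord0 !coordD.
  rewrite !model_coord_br // -[RHS](structure_jacobi (model_coord X)
    (model_coord Y) (model_coord Z) Hfam k6).
  by do 2?congr (_ + _); apply: structure_ext => // i i6; rewrite model_coord_br.
Qed.

Lemma model_coord_h k : (0 < k <= 6)%N -> model_coord model_h k = (k == 6%N)%:R.
Proof.
by case: k => // k k6; rewrite (model_coordE _ (Ordinal (k6 : (k < 6)%N))) mxE.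
Qed.

Lemma coord_th X k : (0 < k <= 5)%N -> ev (model_th (ix k)) X = model_coord X k.
Proof. by rewrite /coord; case: eqP => // ->. Qed.

Lemma coord_ga3 X : ev model_ga3 X = model_coord X 6.
Proof. by []. Qed.

(** Bracketing with [model_h] rotates the coframe by [E3], so the invariance of
    the metric and of [Upsilon] follows from that of the metric and of the cubic
    under [E3]. *)
Lemma model_th_br X i : ev (model_th i) (model_br model_h X)
  = act (E3 R) (fun j => ev (model_th j) X) i.
Proof.
rewrite /act big_ix; move: (E3 R) (E3_entry R) => M HM.
elim/ord5_ind: i; rewrite !HM // !coord_th // model_coord_br // /structure /minor.
all: by rewrite !model_coord_h //=; ring.
Qed.

Lemma model_structure :
  invariant_SO3_structure model_br model_h (adapted_tensor R) model_th.
Proof.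
split.
- by rewrite dimvf.
- exact: model_lie_bracket.
- apply/eqP=> /rowP /(_ ord_max); rewrite !mxE !eqxx => /eqP.
  by rewrite oner_eq0.
- move=> X; split=> [X0|/vlineP[c ->] i].
    apply/vlineP; exists (X 0 ord_max); apply: model_coord_ext => k k6.
    rewrite coordZ model_coord_h //; case: eqP k6 => [->|/eqP kn] k6.
      by rewrite mulr1 (model_coordE _ ord_max).
    have k5 : (0 < k <= 5)%N.
      by move: k6; rewrite [(k <= 6)%N]leq_eqVlt (negPf kn).
    by rewrite mulr0 -coord_th //; exact: X0.
  change (ev (model_th i) (c *: model_h) = 0).
  rewrite evZ entry_formE mxE eqxx /=.
  by rewrite -val_eqE /= ltn_eqF ?mulr0.
- exact: adapted_tensor_SO3.
- exact: adapted_tensor_adapted.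
- move=> X Y; rewrite /metric.
  change (\sum_i ev (model_th i) (model_br model_h X) * ev (model_th i) Y
    + \sum_i ev (model_th i) X * ev (model_th i) (model_br model_h Y) = 0).
  rewrite !big_ix !model_th_br /act !big_ix.
  by move: (E3 R) (E3_entry R) => M HM; rewrite !HM //=; ring.
- move=> X Y Z; rewrite /Upsilon !adapted_tensor_sum3.
  rewrite -[RHS](polar_E3 (fun j => ev (model_th j) X)
    (fun j => ev (model_th j) Y) (fun j => ev (model_th j) Z)).
  change (polar_cubic (fun i => ev (model_th i) (model_br model_h X))
      (fun i => ev (model_th i) Y) (fun i => ev (model_th i) Z)
    + polar_cubic (fun i => ev (model_th i) X)
      (fun i => ev (model_th i) (model_br model_h Y)) (fun i => ev (model_th i) Z)
    + polar_cubic (fun i => ev (model_th i) X) (fun i => ev (model_th i) Y)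
      (fun i => ev (model_th i) (model_br model_h Z)) =
    polar_cubic (act (E3 R) (fun j => ev (model_th j) X))
      (fun j => ev (model_th j) Y) (fun j => ev (model_th j) Z)
    + polar_cubic (fun j => ev (model_th j) X)
       (act (E3 R) (fun j => ev (model_th j) Y)) (fun j => ev (model_th j) Z)
    + polar_cubic (fun j => ev (model_th j) X) (fun j => ev (model_th j) Y)
       (act (E3 R) (fun j => ev (model_th j) Z))).
  by rewrite /polar_cubic /polar_square /polar_product !model_th_br.
Qed.

Lemma model_normal : connection_normal_form model_th model_ga1 model_ga2 a b.
Proof. by []. Qed.

(** The commutators of [E3] with [E1] and [E2] match the rotation of
    [model_ga1, model_ga2] by [h], and the torsion equation is the definition of
    the bracket read backwards. *)
Lemma model_connection : characteristic_connection model_br model_h model_th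
  model_ga1 model_ga2 model_ga3 (normal_torsion t1 t2).
Proof.
have g1E X : ev model_ga1 X = - b * ev (model_th (ix 3)) X + a * ev (model_th (ix 5)) X.
  by rewrite ev_formD !ev_formZ.
have g2E X : ev model_ga2 X = a * ev (model_th (ix 3)) X + b * ev (model_th (ix 5)) X.
  by rewrite ev_formD !ev_formZ.
have [sk12 sk23] := normal_torsion_skew t1 t2.
split=> //.
- move=> i j.
  change (ev (Gamma model_ga1 model_ga2 model_ga3 i j) model_h = E3 R i j).
  rewrite Gamma_ev g1E g2E !coord_th // coord_ga3 !model_coord_h //=.
  by ring.
- move=> i j X.
  change (ev (Gamma model_ga1 model_ga2 model_ga3 i j) (model_br model_h X) =
    \sum_k (E3 R i k * ev (Gamma model_ga1 model_ga2 model_ga3 k j) X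
            - ev (Gamma model_ga1 model_ga2 model_ga3 i k) X * E3 R k j)).
  have -> : \sum_k (E3 R i k * ev (Gamma model_ga1 model_ga2 model_ga3 k j) X
            - ev (Gamma model_ga1 model_ga2 model_ga3 i k) X * E3 R k j)
    = (E3 R *m E1 R - E1 R *m E3 R) i j * ev model_ga1 X
      + (E3 R *m E2 R - E2 R *m E3 R) i j * ev model_ga2 X.
    move: (E1 R) (E2 R) (E3 R) (Gamma_ev model_ga1 model_ga2 model_ga3).
    move=> M1 M2 M3 GE.
    rewrite !mxE -!sumrB !mulr_suml -big_split; apply: eq_bigr => k _ /=.
    by rewrite !GE; ring.
  rewrite E3E1_bracket E3E2_bracket Gamma_ev [(- E1 R) i j]mxE.
  have -> : ev model_ga1 (model_br model_h X) = - ev model_ga2 X.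
    rewrite g1E g2E !coord_th // !model_coord_br // /structure /minor.
    by rewrite !model_coord_h //=; ring.
  have -> : ev model_ga2 (model_br model_h X) = ev model_ga1 X.
    rewrite g1E g2E !coord_th // !model_coord_br // /structure /minor.
    by rewrite !model_coord_h //=; ring.
  have -> : ev model_ga3 (model_br model_h X) = 0.
    rewrite coord_ga3 model_coord_br // /structure /minor.
    by rewrite !model_coord_h //=; field.
  by ring.
- move=> i X Y; rewrite ext_dE.
  elim/ord5_ind: i; rewrite coord_th // model_coord_br //.
  all: rewrite -(torsion_structure model_ga3 X Y _ model_normal (fun i j k => erefl)) //.
  all: by ring.
Qed.

Lemma model_system : homogeneous_system model_br model_h (adapted_tensor R) model_th
  model_ga1 model_ga2 model_ga3 (normal_torsion t1 t2).
Proof.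
split; [exact: model_structure | | exact: model_connection].
exact: characteristic_nearly_integrable model_connection.
Qed.

End Model.

Theorem proposition6p3 (R : realType) :
  (forall (g : vectType R) (br : g -> g -> g) (h : g)
      (U : 'I_5 -> 'I_5 -> 'I_5 -> R) (th : 'I_5 -> form1 g)
      (ga1 ga2 ga3 : form1 g) (T : 'I_5 -> 'I_5 -> 'I_5 -> R),
    homogeneous_system br h U th ga1 ga2 ga3 T ->
    (exists t1 t2 : R, torsion_normal_form th T t1 t2) /\
    (exists a b : R, connection_normal_form th ga1 ga2 a b))
  /\
  (forall a b t1 t2 : R,
    (exists (g : vectType R) (br : g -> g -> g) (h : g)
        (U : 'I_5 -> 'I_5 -> 'I_5 -> R) (th : 'I_5 -> form1 g)
        (ga1 ga2 ga3 : form1 g) (T : 'I_5 -> 'I_5 -> 'I_5 -> R),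
      [/\ homogeneous_system br h U th ga1 ga2 ga3 T,
          torsion_normal_form th T t1 t2
        & connection_normal_form th ga1 ga2 a b])
    <->
    [\/ [/\ b = 0, t1 = 0 & t2 = 0],
        a = 0 /\ b = 0
      | a = 0 /\ b = (t1 - 2 * t2) / (2 * Num.sqrt 3)]).

Proof.
split=> [g br h U th ga1 ga2 ga3 T [S _ C]|a b t1 t2].
  split; last exact: connection_normal S C.
  have [t1 [t2 HT]] := torsion_normal S C.
  by exists t1, t2; exact: torsion_form_normal HT.
split=> [[g [br [h [U [th [ga1 [ga2 [ga3 [T [[S _ C] Ht Hc]]]]]]]]]]|fam].
  exact (parameter_families S C Ht Hc).
exists ('rV[R]_6 : vectType R), (model_br a b t1 t2), (model_h R), (adapted_tensor R).
exists (model_th R), (model_ga1 a b), (model_ga2 a b), (model_ga3 R).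
exists (normal_torsion t1 t2); split; first exact: model_system.
  exact: torsion_form_normal.
exact: model_normal.
Qed.
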